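(* Let $d\ge 3$ and let $(d,m,t)$ be one of the following triples: (1) $d\equiv0\pmod4$, $m=d/2$, and $d=2^t\cdot b$ with $t$ maximal ($b$ an odd integer); (2) $d\equiv1\pmod4$, $m=(d-1)/2$, and $d-1=2^t\cdot b$ with $t$ maximal; (3) $d\equiv3\pmod4$, $m=(d+1)/2$, and $d+1=2^t\cdot b$ with $t$ maximal. Consider positively weighted extremal designs of the hypercube graph $Q_d$ with respect to frequency order, over all admissible choices of the last eigenspace (ties being broken arbitrarily). Then the smallest such designs have at most $2^{d-t}$ elements, and they are obtained by choosing $\Lambda_m$ to be last in frequency order.
   Context: $Q_d$ is the edge graph of the $d$-dimensional hypercube: vertex set $\{0,1\}^d$, two vertices adjacent iff they differ in exactly one coordinate; it is $d$-regular. Its eigenvalues and eigenspaces are those of $\frac1dA$ with $A$ the adjacency matrix: for $i=0,\dots,d$ the eigenvalue $1-2i/d$ has eigenspace $\Lambda_i$ with basis $\{\phi_x : x\in\{0,1\}^d,\ |x|=i\}$, where $\phi_x(y)=(-1)^{x^\top y}$ and $|x|$ is the number of ones in $x$. Frequency order means that the eigenspaces are ordered by decreasing absolute value of the eigenvalue, with $\Lambda_0=\operatorname{span}\{\mathbb{1}\}$ first and ties broken by choice. For even $d$ the last eigenspace is $\Lambda_{d/2}$; for odd $d$ either of $\Lambda_{(d-1)/2}$ (eigenvalue $1/d$) and $\Lambda_{(d+1)/2}$ (eigenvalue $-1/d$) may be chosen to be last. A vertex subset $W$ with weights $(a_w)_{w\in W}$ averages an eigenspace $\Lambda$ if $\sum_{w\in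 W}a_w\phi(w)=\frac1{2^d}\sum_{y\in\{0,1\}^d}\phi(y)$ for all $\phi\in\Lambda$. $W$ is a positively weighted extremal design if there are weights $a_w>0$ with which $W$ averages all eigenspaces except the last one. *)

(* Defs.v *)
From HB Require Import structures.
From mathcomp Require Import all_boot all_order all_fingroup all_algebra.
From mathcomp Require Import reals.

Set Implicit Arguments.
Unset Strict Implicit.
Unset Printing Implicit Defensive.

Import Order.TTheory GRing.Theory Num.Theory.
Local Open Scope ring_scope.

Notation cube d := {ffun 'I_d -> bool}.

Definition cube_graph (d : nat) : rel (cube d) :=
  [rel x y : cube d | #|[set i | x i != y i]| == 1%N].

(* Matrices are indexed by ordinals, so vertices are listed by [enum_val]. *)
Definition adjmx (R : realType) (T : finType) (e : rel T) : 'M[R]_#|T| :=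
  \matrix_(i, j) (e (enum_val i) (enum_val j))%:R.

Definition cube_eigenvalue (R : realType) (d : nat) (i : 'I_d.+1) : R :=
  1 - 2 * i%:R / d%:R.

(* Row space of vectors v with v *m (A / d) = (1 - 2 i / d) *: v; as A is
   symmetric, left and right eigenvectors agree. *)
Definition Lambda (R : realType) (d : nat) (i : 'I_d.+1) :
    'M[R]_#|{: cube d}| :=
  eigenspace (d%:R^-1 *: adjmx R (@cube_graph d)) (cube_eigenvalue R i).

(* A permutation s lists the eigenspaces as Lambda (s 0), ..., Lambda (s d). *)
Definition frequency_order (R : realType) (d : nat) (s : 'S_d.+1) : Prop :=
  s ord0 = ord0 /\
  forall j k : 'I_d.+1, (j <= k)%N ->
    `|cube_eigenvalue R (s k)| <= `|cube_eigenvalue R (s j)|.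

Definition averages (R : realType) (d : nat) (W : {set cube d})
    (a : cube d -> R) (L : 'M[R]_#|{: cube d}|) : Prop :=
  forall phi : cube d -> R,
    (\row_k phi (enum_val k) <= L)%MS ->
    \sum_(w in W) a w * phi w = (2 ^+ d)^-1 * \sum_y phi y.

Definition pos_extremal_design (R : realType) (d : nat) (s : 'S_d.+1)
    (W : {set cube d}) : Prop :=
  exists a : cube d -> R,
    (forall w, w \in W -> 0 < a w) /\
    (forall j : 'I_d.+1, j != ord_max -> averages W a (Lambda R (s j))).

(* W has minimum size among the designs for all frequency orders, i.e. for
   all ways of breaking ties, and is a design for the order s. *)
Definition smallest_design (R : realType) (d : nat) (s : 'S_d.+1)
    (W : {set cube d}) : Prop :=
  [/\ frequency_order R s, pos_extremal_design R s W &
      forall (s' : 'S_d.+1) (W' : {set cube d}),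
        frequency_order R s' -> pos_extremal_design R s' W' ->
        (#|W| <= #|W'|)%N].

(* The oddness of b expresses that t is maximal. *)
Definition is_two_exponent (n t : nat) : Prop :=
  exists b : nat, odd b /\ n = (2 ^ t * b)%N.

Definition admissible_triple (d m t : nat) : Prop :=
  [\/ [/\ d = 0 %[mod 4], m = d %/ 2 & is_two_exponent d t],
      [/\ d = 1 %[mod 4], m = (d - 1) %/ 2 & is_two_exponent (d - 1) t] |
      [/\ d = 3 %[mod 4], m = (d + 1) %/ 2 & is_two_exponent (d + 1) t]]%N.

(* Main.v *)
Require Import Defs.
From mathcomp Require Import all_boot all_order all_fingroup all_algebra.
From mathcomp Require Import boolp reals.
From mathcomp Require Import zify ring.

(** Fix a last level [m].  Positive weights averaging every other eigenspace
    amount to a nonnegative function on the cube whose Fourier expansion is a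
    constant plus characters of level [m].  Two facts about such functions
    decide the theorem.

    Upper bound.  Let [C] be a linear code of dimension [t] all of whose nonzero
    words have weight [m].  Summing the characters of the codewords gives
    [2 ^ t] times the indicator of the dual code, so the dual code with equal
    weights is a design ([dual_code_averages]), and it has [2 ^ (d - t)] points
    ([card_dual_code]).  Here the averaging of all eigenfunctions, and not only
    of characters, follows from the orthogonality of eigenfunctions for distinct
    eigenvalues ([chi_orthogonal]).  Such a code exists for every admissible
    triple: repeat the simplex code of length [2 ^ t - 1] and weight
    [2 ^ (t - 1)] exactly [b] times and pad with zero coordinates
    ([simplex_constant_weight]).  This requires [m = 2 ^ (t - 1) * b] and
    [b * (2 ^ t - 1) <= d], which hold in all three cases
    ([admissible_arith]).

    Lower bound.  In each case [m] is even and [t >= 2].  The only other level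
    that can come last is [d - m] with [d] odd, hence an odd level
    ([frequency_order_last]).  Characters of odd level change sign under the
    antipodal map, so the weights of antipodal points add up to the constant
    term, which is positive; a design therefore meets every antipodal pair and
    has at least [2 ^ (d - 1)] points ([odd_level_large]).  Since
    [2 ^ (d - t) < 2 ^ (d - 1)], no minimum design arises from the odd
    level. *)

Set Implicit Arguments.
Unset Strict Implicit.
Unset Printing Implicit Defensive.

Import Order.TTheory GRing.Theory Num.Theory.
Local Open Scope ring_scope.

(** * Characters of the cube *)

Definition zero (d : nat) : cube d := [ffun=> false].

Definition weight (d : nat) (x : cube d) : nat := #|[set i | x i]|.

Definition dot (d : nat) (x y : cube d) : bool :=
  \big[addb/false]_i (x i && y i).

Definition chi (R : pzRingType) (d : nat) (x y : cube d) : R := (-1) ^+ dot x y.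

Lemma sign_addb_sum (R : pzRingType) (I : finType) (F : I -> bool) :
  (-1) ^+ (\big[addb/false]_i F i) = \prod_i (-1) ^+ F i :> R.
Proof. exact: (big_morph (fun b : bool => (-1) ^+ b) (@signr_addb R)). Qed.

Lemma chiE (R : pzRingType) (d : nat) (x y : cube d) :
  chi R x y = \prod_i (-1) ^+ (x i && y i).
Proof. exact: sign_addb_sum. Qed.

Lemma dotC (d : nat) (x y : cube d) : dot x y = dot y x.
Proof. by apply: eq_bigr => i _; rewrite andbC. Qed.

Lemma dot0x (d : nat) (y : cube d) : dot (zero d) y = false.
Proof. by apply: big1 => i _; rewrite ffunE. Qed.

Lemma dotx0 (d : nat) (y : cube d) : dot y (zero d) = false.
Proof. by rewrite dotC dot0x. Qed.

Lemma chi_sym (R : pzRingType) (d : nat) (x y : cube d) : chi R x y = chi R y x.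
Proof. by rewrite /chi dotC. Qed.

Lemma chi0x (R : pzRingType) (d : nat) (y : cube d) : chi R (zero d) y = 1.
Proof. by rewrite /chi dot0x. Qed.

Lemma chix0 (R : pzRingType) (d : nat) (y : cube d) : chi R y (zero d) = 1.
Proof. by rewrite chi_sym chi0x. Qed.

Lemma weight_eq0 (d : nat) (x : cube d) : (weight x == 0%N) = (x == zero d).
Proof.
rewrite cards_eq0; apply/eqP/eqP => [x0|->].
  apply/ffunP => i; rewrite ffunE; apply/negbTE/negP => xi.
  by have := in_set0 i; rewrite -x0 inE xi.
by apply/setP => i; rewrite !inE ffunE.
Qed.

(** The product form of the characters turns the sum over the cube into a
    product over coordinates, whose factors are 2 or 0 according to whether the
    two points agree there. *)
Lemma chi_inversion (R : comPzRingType) (d : nat) (y z : cube d) :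
  \sum_x chi R x y * chi R x z = 2 ^+ d *+ (y == z).
Proof.
under eq_bigr => x _ do rewrite !chiE -big_split /=.
rewrite -(bigA_distr_bigA (fun (i : 'I_d) (b : bool) =>
  (-1) ^+ (b && y i) * (-1) ^+ (b && z i) : R)) /=.
have coord i : \sum_(b : bool) (-1) ^+ (b && y i) * (-1) ^+ (b && z i)
    = (2 *+ (y i == z i) : R).
  by rewrite big_bool /=; case: (y i); case: (z i); rewrite /= ?mulr0n; ring.
under eq_bigr => i _ do rewrite coord.
case: eqP => [->|/eqP yz].
  by under eq_bigr do rewrite eqxx; rewrite prodr_const card_ord.
have [i yzi] : exists i, y i != z i.
  by apply/existsP; rewrite -negb_forall; apply: contra yz => /forallP yz;
     apply/eqP/ffunP => i; apply/eqP.
by rewrite (bigD1 i) //= (negbTE yzi) mul0r.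
Qed.

Lemma sum_chi (R : comPzRingType) (d : nat) (y : cube d) :
  \sum_x chi R x y = 2 ^+ d *+ (y == zero d).
Proof.
by rewrite -chi_inversion; apply: eq_bigr => x _; rewrite chix0 mulr1.
Qed.

(** * Eigenfunctions of the hypercube *)

Definition flip (d : nat) (i : 'I_d) (y : cube d) : cube d :=
  [ffun k => y k (+) (k == i)].

Lemma flipK (d : nat) (i : 'I_d) : involutive (@flip d i).
Proof. by move=> y; apply/ffunP => k; rewrite !ffunE addbK. Qed.

(** Writing adjacency as a sum over directions replaces the sum over the
    neighbours of a point by a sum over coordinates. *)
Lemma cube_adj_flip (d : nat) (z y : cube d) :
  (cube_graph z y : nat) = (\sum_(i < d) (z == flip i y))%N.
Proof.
have diff i : [set k | flip i y k != y k] = [set i].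
  by apply/setP => k; rewrite !inE ffunE; case: (y k); case: (k == i).
case zy: (cube_graph z y); last first.
  rewrite big1 // => i _; case: eqP => // zE.
  by move: zy; rewrite /cube_graph /= zE diff cards1.
have /cards1P[i zyi] := zy.
have zE : z = flip i y.
  apply/ffunP => k; move/setP/(_ k): zyi; rewrite !inE ffunE => <-.
  by case: (z k); case: (y k).
rewrite (bigD1 i) //= big1 ?zE ?eqxx // => j ji.
case: eqP => // flips; move: (diff j); rewrite -flips diff => /set1_inj ij.
by rewrite ij eqxx in ji.
Qed.

(** Membership in an eigenspace, freed from matrices: the eigenvalue equation
    multiplied by [d]. *)
Lemma Lambda_flip (R : realType) (d : nat) (i : 'I_d.+1) (phi : cube d -> R) :
  (0 < d)%N ->
  reflect (forall y, \sum_k phi (flip k y) = (d%:R - 2 * i%:R) * phi y)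
          (\row_k phi (enum_val k) <= Lambda R i)%MS.
Proof.
move=> d_gt0; have d_neq0 : d%:R != 0 :> R by rewrite pnatr_eq0 -lt0n.
have entry y :
    ((\row_k phi (enum_val k)) *m (d%:R^-1 *: adjmx R (@cube_graph d)))
      0 (enum_rank y) = d%:R^-1 * \sum_k phi (flip k y).
  rewrite mxE.
  transitivity (\sum_z phi z * (d%:R^-1 * (cube_graph z y)%:R)).
    rewrite [RHS](reindex (enum_val : 'I_#|{: cube d}| -> cube d)) /=;
      last exact/onW_bij/enum_val_bij.
    apply: eq_bigr => k _.
    by rewrite !mxE enum_rankK.
  rewrite mulr_sumr.
  transitivity (\sum_z \sum_k d%:R^-1 * (phi z *+ (z == flip k y))).
    apply: eq_bigr => z _; rewrite cube_adj_flip natr_sum !mulr_sumr.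
    by apply: eq_bigr => k _; rewrite mulrCA mulr_natr.
  rewrite exchange_big /=; apply: eq_bigr => k _.
  rewrite (bigD1 (flip k y)) //= eqxx big1 ?addr0 // => z /negbTE ->.
  by rewrite mulr0.
apply: (iffP eigenspaceP) => [eig y|eig].
  have /rowP/(_ (enum_rank y)) := eig; rewrite entry !mxE enum_rankK.
  rewrite /cube_eigenvalue => e; apply: (mulfI (invr_neq0 d_neq0)).
  by rewrite e; field.
apply/rowP => k; rewrite -[k]enum_valK entry !mxE enum_rankK eig.
by rewrite /cube_eigenvalue; field.
Qed.

Lemma chi_flip (R : comPzRingType) (d : nat) (x y : cube d) (k : 'I_d) :
  chi R x (flip k y) = (-1) ^+ x k * chi R x y.
Proof.
have single : (-1) ^+ x k = \prod_i (-1) ^+ (x i && (i == k)) :> R.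
  rewrite (bigD1 k) //= eqxx andbT big1 ?mulr1 // => i /negbTE ->.
  by rewrite andbF.
rewrite single !chiE -big_split /=; apply: eq_bigr => i _.
by rewrite -signr_addb ffunE; case: (x i); case: (y i); case: (i == k).
Qed.

Lemma sum_chi_flip (R : comPzRingType) (d : nat) (x y : cube d) :
  \sum_k chi R x (flip k y) = (d%:R - 2 * (weight x)%:R) * chi R x y.
Proof.
under eq_bigr do rewrite chi_flip.
rewrite -mulr_suml; congr (_ * _).
have sgn k : (-1) ^+ x k = 1 - 2 * (x k)%:R :> R.
  by case: (x k) => /=; ring.
under eq_bigr do rewrite sgn.
rewrite sumrB sumr_const card_ord -mulr_sumr -natr_sum; congr (_ - _ * _%:R).
rewrite /weight -sum1dep_card [RHS]big_mkcond.
by apply: eq_bigr => k _; case: (x k).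
Qed.

Lemma chi_Lambda (R : realType) (d : nat) (i : 'I_d.+1) (x : cube d) :
  (0 < d)%N -> weight x = i -> (\row_k chi R x (enum_val k) <= Lambda R i)%MS.
Proof. by move=> ? xi; apply/Lambda_flip => // y; rewrite sum_chi_flip xi. Qed.

(** The operator that sums over neighbours is self-adjoint, so eigenfunctions
    for different eigenvalues are orthogonal. *)
Lemma chi_orthogonal (R : realType) (d : nat) (i : 'I_d.+1) (x : cube d)
    (phi : cube d -> R) :
  (0 < d)%N -> weight x != i -> (\row_k phi (enum_val k) <= Lambda R i)%MS ->
  \sum_y chi R x y * phi y = 0.
Proof.
move=> d_gt0 xi /(Lambda_flip _ _ d_gt0) eig.
have adj : \sum_y chi R x y * \sum_k phi (flip k y)
         = \sum_y (\sum_k chi R x (flip k y)) * phi y.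
  under eq_bigr do rewrite mulr_sumr.
  under [RHS]eq_bigr do rewrite mulr_suml.
  rewrite exchange_big [RHS]exchange_big /=; apply: eq_bigr => k _.
  rewrite (reindex_inj (inv_inj (@flipK d k))) /=.
  by apply: eq_bigr => y _; rewrite flipK.
have : (d%:R - 2 * i%:R) * \sum_y chi R x y * phi y
     = (d%:R - 2 * (weight x)%:R) * \sum_y chi R x y * phi y.
  rewrite !mulr_sumr; transitivity (\sum_y chi R x y * \sum_k phi (flip k y)).
    by apply: eq_bigr => y _; rewrite eig mulrCA.
  by rewrite adj; apply: eq_bigr => y _; rewrite sum_chi_flip mulrA.
move/eqP; rewrite -subr_eq0 -mulrBl mulf_eq0 => /orP[|/eqP//].
rewrite opprB addrC addrA subrK -mulrBr mulf_eq0 pnatr_eq0 /= subr_eq0 eqr_nat.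
by rewrite (negbTE xi).
Qed.

(** * Designs for an odd last eigenspace *)

Definition antipode (d : nat) (y : cube d) : cube d := [ffun i => ~~ y i].

Lemma antipodeK (d : nat) : involutive (@antipode d).
Proof. by move=> y; apply/ffunP => i; rewrite !ffunE negbK. Qed.

Lemma chi_antipode (R : comPzRingType) (d : nat) (x y : cube d) :
  chi R x (antipode y) = (-1) ^+ odd (weight x) * chi R x y.
Proof.
have -> : (-1) ^+ odd (weight x) = \prod_i (-1) ^+ x i :> R.
  rewrite signr_odd -prodr_const big_mkcond; apply: eq_bigr => i _.
  by rewrite inE; case: (x i).
rewrite !chiE -big_split /=; apply: eq_bigr => i _.
by rewrite ffunE -signr_addb; case: (x i); case: (y i).
Qed.

Lemma averages_chi (R : realType) (d : nat) (W : {set cube d})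
    (a : cube d -> R) (i : 'I_d.+1) (x : cube d) :
  (0 < d)%N -> averages W a (Lambda R i) -> weight x = i ->
  \sum_(w in W) a w * chi R x w = (x == zero d)%:R.
Proof.
move=> d_gt0 avg xi; rewrite (avg _ (chi_Lambda R d_gt0 xi)).
under eq_bigr do rewrite chi_sym.
by rewrite sum_chi mulrnAr mulVf ?expf_neq0 ?pnatr_eq0.
Qed.

(** Characters of even weight agree at [y] and its antipode and those of odd
    weight cancel, so the indicator of this antipodal pair is a combination of
    characters of even weight.  The weights average all of these, hence also the
    indicator, whose mean is positive. *)
Lemma meets_antipodal_pairs (R : realType) (d : nat) (W : {set cube d})
    (a : cube d -> R) (y : cube d) :
  (forall x, ~~ odd (weight x) ->
     \sum_(w in W) a w * chi R x w = (x == zero d)%:R) ->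
  (y \in W) || (antipode y \in W).
Proof.
move=> avg; apply: contraT; rewrite negb_or => /andP[yW ayW].
(* 2 ^ d times the indicator of the pair, summed against the weights *)
have pair0 : \sum_(w in W) a w *
    \sum_x (chi R x y + chi R x (antipode y)) * chi R x w = 0.
  apply: big1 => w wW; under eq_bigr do rewrite mulrDl.
  rewrite big_split /= !chi_inversion.
  have /negbTE -> : y != w by apply: contraNneq yW => ->.
  have /negbTE -> : antipode y != w by apply: contraNneq ayW => ->.
  by rewrite addr0 mulr0.
have term x : \sum_(w in W) a w *
    ((chi R x y + chi R x (antipode y)) * chi R x w) = 2 *+ (x == zero d).
  under eq_bigr do rewrite mulrCA.
  rewrite -mulr_sumr chi_antipode; case: (boolP (odd (weight x))) => xodd.
    case: eqP xodd => [->|_ _]; last by rewrite mulN1r subrr mul0r.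
    by have /eqP -> : weight (zero d) == 0%N by rewrite weight_eq0.
  rewrite avg // mul1r; case: eqP => [->|_]; last by rewrite mulr0.
  by rewrite chi0x mulr1.
have pair2 : \sum_(w in W) a w *
    \sum_x (chi R x y + chi R x (antipode y)) * chi R x w = 2.
  under eq_bigr do rewrite mulr_sumr.
  rewrite exchange_big /=; under eq_bigr do rewrite term.
  by rewrite (bigD1 (zero d)) //= eqxx big1 ?addr0 // => x /negbTE ->.
by move/eqP: pair2; rewrite pair0 eq_sym pnatr_eq0.
Qed.

(** The cube is covered by [W] and its antipodal image. *)
Lemma odd_level_large (R : realType) (d : nat) (s : 'S_d.+1)
    (W : {set cube d}) :
  (0 < d)%N -> odd (s ord_max) -> pos_extremal_design R s W ->
  (2 ^ d <= 2 * #|W|)%N.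
Proof.
move=> d_gt0 sodd [a [_ avg]].
have cover y : (y \in W) || (antipode y \in W).
  apply: (@meets_antipodal_pairs R _ _ a) => x xeven.
  have x_le : (weight x < d.+1)%N by rewrite ltnS -[leqRHS]card_ord max_card.
  apply: (@averages_chi _ _ _ _ (s (perm_inv s (Ordinal x_le)))) => //.
    apply: avg; apply: contraNneq xeven => e; rewrite -e permKV in sodd.
    exact: sodd.
  by rewrite permKV.
have -> : (2 ^ d = #|[set: cube d]|)%N.
  by rewrite cardsT card_ffun card_bool card_ord.
have -> : [set: cube d] = W :|: (@antipode d) @^-1: W.
  by apply/setP => y; rewrite !inE cover.
rewrite mul2n -addnn; apply: leq_trans (leq_card_setU _ _) _.
rewrite leq_add2l on_card_preimset //.
by exists (@antipode d) => y _; rewrite antipodeK.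
Qed.

(** * Duals of constant-weight codes *)

Definition encode (d t : nat) (v : 'I_d -> cube t) (u : cube t) : cube d :=
  [ffun i => dot u (v i)].

Definition syndrome (d t : nat) (v : 'I_d -> cube t) (y : cube d) : cube t :=
  [ffun k => \big[addb/false]_i (v i k && y i)].

Definition dual_code (d t : nat) (v : 'I_d -> cube t) : {set cube d} :=
  [set y | syndrome v y == zero t].

(** Encoding and syndrome are adjoint: as matrices over the two-element field
    they are transposes of each other. *)
Lemma dot_encode (d t : nat) (v : 'I_d -> cube t) (u : cube t) (y : cube d) :
  dot (encode v u) y = dot u (syndrome v y).
Proof.
rewrite /dot; under eq_bigr do rewrite ffunE /dot big_distrl /=.
rewrite exchange_big /=; apply: eq_bigr => k _; rewrite ffunE big_distrr /=.
by apply: eq_bigr => i _; rewrite andbA.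
Qed.

Lemma encode0 (d t : nat) (v : 'I_d -> cube t) : encode v (zero t) = zero d.
Proof. by apply/ffunP => i; rewrite !ffunE dot0x. Qed.

(** The indicator of the dual code is, up to scaling, the sum of the characters
    of the codewords, and all codewords but zero have weight [m]. *)
Lemma dual_code_averages (R : realType) (d t m : nat) (v : 'I_d -> cube t)
    (i : 'I_d.+1) :
  (0 < d)%N -> (forall u, u != zero t -> weight (encode v u) = m) ->
  nat_of_ord i != m ->
  averages (dual_code v) (fun=> 2 ^+ t / 2 ^+ d) (Lambda R i).
Proof.
move=> d_gt0 wm im phi phiL.
transitivity ((2 ^+ d)^-1 * \sum_y \sum_u chi R (encode v u) y * phi y).
  rewrite mulr_sumr big_mkcond; apply: eq_bigr => y _ /=.
  rewrite -mulr_suml; under eq_bigr do rewrite /chi dot_encode -/(chi R _ _).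
  rewrite sum_chi inE; case: ifP => _; last by rewrite mulr0n mul0r mulr0.
  by rewrite mulr1n mulrA [2 ^+ t / _]mulrC.
congr (_ * _); rewrite exchange_big /= (bigD1 (zero t)) //=.
rewrite [X in _ + X]big1 ?addr0.
  by apply: eq_bigr => y _; rewrite encode0 chi0x mul1r.
by move=> u u0; apply: chi_orthogonal phiL; rewrite // wm // eq_sym.
Qed.

(** The equal weights sum to 1, which is the averaging identity for the constant
    function. *)
Lemma card_dual_code (d t m : nat) (R : realType) (v : 'I_d -> cube t) :
  (0 < d)%N -> (0 < m)%N ->
  (forall u, u != zero t -> weight (encode v u) = m) ->
  (#|dual_code v| * 2 ^ t = 2 ^ d)%N.
Proof.
move=> d_gt0 m_gt0 wm.
have avg : averages (dual_code v) (fun=> 2 ^+ t / 2 ^+ d) (Lambda R ord0).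
  by apply: dual_code_averages wm _; rewrite // eq_sym -lt0n.
have w0 : weight (zero d) = 0%N by apply/eqP; rewrite weight_eq0.
have := averages_chi d_gt0 avg w0.
under eq_bigr do rewrite chi0x mulr1.
rewrite sumr_const eqxx -[LHS]mulr_natl mulrA.
move/(canRL (mulfVK _)); rewrite mulr1n mul1r => e.
apply/eqP; rewrite -(eqr_nat R) natrM !natrX e //.
by rewrite expf_neq0 ?pnatr_eq0.
Qed.

(** * Repeated simplex codes *)

(** Columns of a generator matrix of the repeated simplex code: every nonzero
    vector, [b] times. *)
Definition simplex_columns (b t : nat) : seq (cube t) :=
  flatten (nseq b (enum (predC1 (zero t)))).

Lemma size_simplex_columns (b t : nat) :
  size (simplex_columns b t) = (b * (2 ^ t).-1)%N.
Proof.
rewrite size_flatten /shape map_nseq sumn_nseq mulnC -cardE cardC1.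
by rewrite card_ffun card_bool card_ord.
Qed.

Lemma count_simplex_columns (b t : nat) (P : pred (cube t)) :
  ~~ P (zero t) -> count P (simplex_columns b t) = (b * #|P|)%N.
Proof.
move=> P0; rewrite count_flatten map_nseq sumn_nseq mulnC; congr (_ * _)%N.
rewrite -size_filter cardE; congr size.
rewrite /enum_mem -filter_predI; apply: eq_filter => x /=.
by rewrite andb_idr // => Px; apply: contraTneq Px => ->.
Qed.

Lemma card_nth_ord (T : Type) (x0 : T) (s : seq T) (P : pred T) (d : nat) :
  ~~ P x0 -> (size s <= d)%N ->
  #|[set i : 'I_d | P (nth x0 s i)]| = count P s.
Proof.
move=> P0 sd; rewrite -sum1dep_card -sum1_count.
rewrite -(big_mkord (fun i => P (nth x0 s i)) (fun=> 1%N)).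
rewrite (big_cat_nat _ sd) //= [X in (_ + X)%N]big_nat_cond.
rewrite [X in (_ + X)%N]big1 ?addn0.
  by rewrite [RHS](big_nth x0).
by move=> i /andP[/andP[si _]]; rewrite nth_default // (negbTE P0).
Qed.

(** A nontrivial character sums to zero, so it takes both signs equally
    often. *)
Lemma card_dot (t : nat) (u : cube t) :
  u != zero t -> (2 * #|dot u| = 2 ^ t)%N.
Proof.
move=> u0; have := sum_chi int u; rewrite (negbTE u0) mulr0n.
have sgn x : chi int x u = 1 - 2 * (dot u x)%:R.
  by rewrite /chi dotC; case: (dot u x).
under eq_bigr do rewrite sgn.
rewrite sumrB sumr_const -mulr_sumr -natr_sum card_ffun card_bool card_ord.
rewrite -sum1_card [X in _ -> (_ * X = _)%N]big_mkcond /=.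
have -> : (\sum_x (dot u x : nat) = \sum_x (if x \in dot u then 1 else 0))%N.
  by apply: eq_bigr => x _; rewrite -topredE /=; case: (dot u x).
by move/eqP; rewrite subr_eq0 -natrM eqr_nat => /eqP.
Qed.

(** Beyond the end of the list of columns, the default value of [nth] pads the
    code with zero coordinates. *)
Lemma simplex_constant_weight (d t b : nat) (u : cube t) :
  (0 < t)%N -> (b * (2 ^ t).-1 <= d)%N -> u != zero t ->
  weight (encode (fun i : 'I_d => nth (zero t) (simplex_columns b t) i) u)
    = (2 ^ t.-1 * b)%N.
Proof.
move=> t_gt0 bd u0; rewrite /weight.
transitivity (count (dot u) (simplex_columns b t)).
  rewrite -(@card_nth_ord _ (zero t) _ (dot u) d) ?dotx0 //.
    by apply: eq_card => i; rewrite !inE ffunE.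
  by rewrite size_simplex_columns.
rewrite count_simplex_columns ?dotx0 // mulnC; congr (_ * _)%N.
by apply/eqP; rewrite -(eqn_pmul2l (isT : 0 < 2)%N) card_dot // -expnS prednK.
Qed.

(** * Frequency orders *)

(** The distance between [d] and [2 * i] in truncated subtraction; the absolute
    eigenvalue of level [i] is [imbalance d i / d]. *)
Definition imbalance (d i : nat) : nat := ((d - 2 * i) + (2 * i - d))%N.

Lemma norm_cube_eigenvalue (R : realType) (d : nat) (i : 'I_d.+1) :
  (0 < d)%N -> `|cube_eigenvalue R i| = (imbalance d i)%:R / d%:R.
Proof.
move=> d_gt0; have dpos : 0 < d%:R :> R by rewrite ltr0n.
have -> : cube_eigenvalue R i = (d%:R - (2 * i)%:R) / d%:R.
  by rewrite /cube_eigenvalue natrM; field; rewrite lt0r_neq0.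
rewrite normrM [`|_^-1|]gtr0_norm ?invr_gt0 //; congr (_ / _).
rewrite /imbalance natrD; case: (leqP (2 * i) d) => le.
  rewrite (eqP (_ : (2 * i - d)%N == 0%N)) ?subn_eq0 // addr0 natrB //.
  by rewrite ger0_norm // subr_ge0 ler_nat.
rewrite (eqP (_ : (d - 2 * i)%N == 0%N)) ?subn_eq0 1?ltnW // add0r.
by rewrite natrB 1?ltnW // ltr0_norm ?opprB // subr_lt0 ltr_nat.
Qed.

Lemma ler_cube_eigenvalue (R : realType) (d : nat) (i j : 'I_d.+1) :
  (0 < d)%N -> (`|cube_eigenvalue R i| <= `|cube_eigenvalue R j|) =
    (imbalance d i <= imbalance d j)%N.
Proof.
move=> d_gt0; rewrite !norm_cube_eigenvalue // ler_pM2r ?ler_nat //.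
by rewrite invr_gt0 ltr0n.
Qed.

(** The order 0, d, 1, d - 1, ... of the levels, with the last two entries
    arranged so as to end with [m]. *)
Definition level_at (d m k : nat) : nat :=
  (if k == d then m
   else if k == d.-1 then (if odd d then d - m else m.+1)
   else if odd k then d - k./2 else k./2)%N.

Lemma frequency_order_exists (R : realType) (d m : nat) :
  (3 <= d)%N -> (imbalance d m <= odd d)%N ->
  exists2 s : 'S_d.+1, frequency_order R s & nat_of_ord (s ord_max) = m.
Proof.
rewrite /imbalance => d3 md.
have bound k : (k < d.+1)%N -> (level_at d m k < d.+1)%N.
  rewrite /level_at => kd; case: (k =P d) => ?; first lia.
  case: (k =P d.-1) => ?; first by case: ifP; lia.
  by case: ifP; lia.
pose f (k : 'I_d.+1) := Ordinal (bound k (ltn_ord k)).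
have f_inj : injective f.
  move=> [j jd] [k kd] /(congr1 val) /= e; apply: val_inj => /=; move: e.
  rewrite /level_at; repeat case: ifP; lia.
have d_gt0 : (0 < d)%N by lia.
exists (perm f_inj); last by rewrite permE /= /level_at eqxx.
split=> [|[j jd] [k kd] /= jk].
  by rewrite permE; apply: val_inj; rewrite /= /level_at; repeat case: ifP; lia.
rewrite ler_cube_eigenvalue // !permE /= /level_at /imbalance.
repeat case: ifP; lia.
Qed.

(** The last level minimizes the imbalance; [m] attains the minimum, and only
    its mirror image [d - m] can tie with it. *)
Lemma frequency_order_last (R : realType) (d : nat) (s : 'S_d.+1) (m : nat) :
  (3 <= d)%N -> (imbalance d m <= odd d)%N -> frequency_order R s ->
  nat_of_ord (s ord_max) = m \/ odd d /\ nat_of_ord (s ord_max) = (d - m)%N.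
Proof.
rewrite /imbalance => d3 md [_ dec].
have md1 : (m < d.+1)%N by lia.
have := dec (perm_inv s (Ordinal md1)) ord_max (leq_ord _).
rewrite ler_cube_eigenvalue ?permKV /imbalance /=; lia.
Qed.

(** * Arithmetic of admissible triples *)

(** In all three cases the multiple of 4 among [d], [d - 1], [d + 1] equals both
    [2 * m] and [2 ^ t * b]. *)
Lemma admissible_arith (d m t : nat) :
  (3 <= d)%N -> admissible_triple d m t ->
  exists b, [/\ (2 <= t)%N, (0 < m)%N /\ ~~ odd m, m = (2 ^ t.-1 * b)%N,
    (b * (2 ^ t).-1 <= d)%N & (imbalance d m <= odd d)%N].
Proof.
move=> d3 adm.
have {adm} [b [b_odd [n [nb n4 nm bd]]]] : exists b, odd b /\ exists n,
    [/\ n = (2 ^ t * b)%N, n = 0 %[mod 4], n = (2 * m)%N &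
        (n = d \/ n = d.-1 \/ n = d.+1) /\ (n = d -> ~~ odd d)].
  case: adm => -[d4 mE [b [b_odd nb]]]; exists b; split=> //.
  - by exists d; split=> //; lia.
  - by exists (d - 1)%N; split=> //; lia.
  - by exists (d + 1)%N; split=> //; lia.
exists b.
have t2 : (2 <= t)%N.
  by case: t nb => [|[|t]] //; rewrite ?expn0 ?expn1; lia.
have twice : (2 ^ t = 2 * 2 ^ t.-1)%N by rewrite -expnS prednK // ltnW.
have b_gt0 : (0 < b)%N by case: b b_odd {nb}.
split=> //; [lia| |rewrite -subn1 mulnBr; lia|rewrite /imbalance; lia].
by apply/eqP; rewrite -(eqn_pmul2l (isT : 0 < 2)%N) mulnA -twice -nb nm.
Qed.

(** * Minimum designs *)

Lemma smallest_design_exists (R : realType) (d : nat) (s : 'S_d.+1)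
    (W : {set cube d}) :
  frequency_order R s -> pos_extremal_design R s W ->
  exists (s' : 'S_d.+1) (W' : {set cube d}), smallest_design R s' W'.
Proof.
move=> fs dW.
pose P n := `[< exists (s : 'S_d.+1) (W : {set cube d}),
  [/\ frequency_order R s, pos_extremal_design R s W & #|W| = n] >].
have exP : exists n, P n by exists #|W|; apply/asboolP; exists s, W.
have [n /asboolP[s' [W' [fs' dW' cardW']]] min_n] := ex_minnP exP.
exists s', W'; split=> // s2 W2 fs2 dW2; rewrite cardW'.
by apply: min_n; apply/asboolP; exists s2, W2.
Qed.

Theorem theorem5p17 (R : realType) (d m t : nat) (hd : (3 <= d)%N)
    (hdmt : admissible_triple d m t) :
  (exists (s : 'S_d.+1) (W : {set cube d}), smallest_design R s W) /\
  (forall (s : 'S_d.+1) (W : {set cube d}), smallest_design R s W ->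
     (#|W| <= 2 ^ (d - t))%N /\ nat_of_ord (s ord_max) = m).
Proof.
have [b [t2 [m_gt0 m_even] mE bd md]] := admissible_arith hd hdmt.
have d_gt0 : (0 < d)%N by apply: leq_trans hd.
have [s fs sm] := frequency_order_exists R hd md.
pose v (i : 'I_d) := nth (zero t) (simplex_columns b t) i.
have wm u : u != zero t -> weight (encode v u) = m.
  by move=> u0; rewrite mE simplex_constant_weight // ltnW.
have design : pos_extremal_design R s (dual_code v).
  exists (fun=> 2 ^+ t / 2 ^+ d); split=> [w _|j jmax].
    by rewrite divr_gt0 ?exprn_gt0.
  apply: dual_code_averages wm _ => //.
  by apply: contra jmax; rewrite -sm => /eqP/val_inj/perm_inj/eqP.
have sizeE : (#|dual_code v| * 2 ^ t = 2 ^ d)%N.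
  exact: (card_dual_code R d_gt0 m_gt0 wm).
have td : (t <= d)%N.
  rewrite -(leq_exp2l (m := 2)) // -sizeE leq_pmull // lt0n.
  by apply: contra_eq_neq sizeE => /= ->; rewrite mul0n eq_sym expn_eq0.
have {}sizeE : (#|dual_code v| = 2 ^ (d - t))%N.
  by apply/eqP; rewrite -(eqn_pmul2r (expn_gt0 2 t)) sizeE -expnD subnK.
split; first exact: smallest_design_exists fs design.
move=> s' W [fs' dW minW].
have small : (#|W| <= 2 ^ (d - t))%N by rewrite -sizeE; apply: minW fs design.
split=> //.
have [//|[d_odd s'm]] := frequency_order_last hd md fs'.
have : (2 ^ d <= 2 * #|W|)%N.
  apply: (odd_level_large d_gt0 _ dW); rewrite s'm.
  by move: md; rewrite /imbalance; lia.
have : (2 * 2 ^ (d - t) < 2 ^ d)%N by rewrite -expnS ltn_exp2l //; lia.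
lia.
Qed.
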